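(* Let $\mathcal{I}$ be an ideal on $\mathbb{N}$ with the Baire property. Then there is an $\mathcal{I}$-TAD family of cardinality $\mathfrak{c}$.
   Context: For $A\subseteq\mathbb{N}$ and $k\in\mathbb{Z}$, $A+k$ denotes $\{a+k:a\in A\}\cap\mathbb{N}$. An ideal on $\mathbb{N}$ is a family $\mathcal{I}\subseteq\mathcal{P}(\mathbb{N})$ closed under finite unions and subsets, containing all finite subsets of $\mathbb{N}$, with $\mathbb{N}\notin\mathcal{I}$. $\mathcal{I}^+=\{A\subseteq\mathbb{N}:A\notin\mathcal{I}\}$. A family $\mathcal{A}\subseteq\mathcal{P}(\mathbb{N})$ is an $\mathcal{I}$-TAD family if $\mathcal{A}\subseteq\mathcal{I}^+$ and $A\cap(B+k)\in\mathcal{I}$ for all distinct $A,B\in\mathcal{A}$ and all $k\in\mathbb{Z}$. Subsets of $\mathbb{N}$ are identified with their characteristic functions, so $\mathcal{P}(\mathbb{N})$ carries the topology of the Cantor space $\{0,1\}^{\mathbb{N}}$; an ideal has the Baire property if it has the Baire property as a subset of this space. $\mathfrak{c}$ is the cardinality of the continuum. *)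

(* Defs.v *)
From HB Require Import structures.
From mathcomp Require Import all_boot all_order all_algebra.
From mathcomp Require Import all_classical all_reals all_analysis.

Set Implicit Arguments.
Unset Strict Implicit.
Unset Printing Implicit Defensive.

Import Order.TTheory GRing.Theory Num.Theory.

Local Open Scope classical_set_scope.
Local Open Scope ring_scope.

(* The intersection with N is enforced by the type of n, while the equation
   n = a + k is between integers, so k may be negative. *)
Definition translate (A : set nat) (k : int) : set nat :=
  [set n : nat | exists2 a : nat, A a & n%:Z = a%:Z + k].

Definition is_ideal (I : set (set nat)) : Prop :=
  [/\ forall A B, I A -> I B -> I (A `|` B),
      forall A B, B `<=` A -> I A -> I B,
      forall A, finite_set A -> I A
    & ~ I [set: nat]].

Definition ideal_pos (I : set (set nat)) : set (set nat) := [set A | ~ I A].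

Definition TAD_family (I F : set (set nat)) : Prop :=
  F `<=` ideal_pos I /\
  forall A B, F A -> F B -> A <> B ->
    forall k : int, I (A `&` translate B k).

Definition nowhere_dense (T : topologicalType) (A : set T) : Prop :=
  interior (closure A) = set0.

Definition meager (T : topologicalType) (A : set T) : Prop :=
  exists2 F : nat -> set T,
    forall n, nowhere_dense (F n) & A = \bigcup_n F n.

Definition Baire_property (T : topologicalType) (A : set T) : Prop :=
  exists2 U : set T, open U & meager (A `+` U).

Definition char_fun (A : set nat) : cantor_space := fun n => n \in A.

Definition ideal_Baire_property (I : set (set nat)) : Prop :=
  Baire_property (char_fun @` I).

(* Main.v *)
Require Import Defs.
From HB Require Import structures.
From mathcomp Require Import all_boot all_order all_algebra.
From mathcomp Require Import all_classical all_reals all_analysis.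
From mathcomp Require Import zify lra.

Import Order.TTheory GRing.Theory Num.Theory.
Import numFieldNormedType.Exports.

Local Open Scope classical_set_scope.
Local Open Scope card_scope.

(** An ideal [I] with the Baire property is meager: otherwise it is comeager in
    some cylinder, and flipping the tail of a generic point there produces
    two members of [I] with cofinite union. A meager set of sequences misses
    every sequence that agrees with a suitable [s] on infinitely many of
    suitable blocks [[a k, b k)], whose gaps can be made as long as desired.
    If [I] contained the union of infinitely many of these blocks, it would
    also contain its intersection with the support of [s], which agrees with
    [s] on them; this is Talagrand's theorem. Attach to every branch [x] of
    the binary tree the union of the blocks coded by the initial segments of
    [x]. Distinct branches share only finitely many blocks, and the gaps
    make all shifted intersections of the attached sets finite. *)

Lemma nowhere_denseP (T : topologicalType) (G : set T) :
  nowhere_dense G <-> dense (~` closure G).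
Proof.
split=> [G0 O [x Ox] oO|dG].
  apply: contrapT => OG; suff: interior (closure G) x by rewrite G0.
  apply: filterS (open_nbhs_nbhs (conj oO Ox)) => y Oy.
  by apply: contrapT => yG; apply: OG; exists y.
rewrite /nowhere_dense -subset0 => x xG.
have [y [/interior_subset yG /(_ yG)]] // :=
  dG (interior (closure G)) (ex_intro _ x xG) (open_interior _).
Qed.

Lemma nowhere_dense0 (T : topologicalType) : nowhere_dense (@set0 T).
Proof. by rewrite /nowhere_dense closure0 interior0. Qed.

Lemma nowhere_denseS (T : topologicalType) (G H : set T) :
  G `<=` H -> nowhere_dense H -> nowhere_dense G.
Proof.
rewrite /nowhere_dense -!subset0 => GH; apply: subset_trans.
exact/interiorS/closureS.
Qed.

Lemma nowhere_denseU [T : topologicalType] [G H : set T] :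
  nowhere_dense G -> nowhere_dense H -> nowhere_dense (G `|` H).
Proof.
rewrite !nowhere_denseP closureU setCU; apply: denseI.
exact/closed_openC/closed_closure.
Qed.

Lemma nowhere_dense_bigcup {T : topologicalType} {F : nat -> set T} n :
  (forall k, nowhere_dense (F k)) -> nowhere_dense (\bigcup_(k < n) F k).
Proof.
move=> Fnd; rewrite bigcup_mkord.
elim/big_ind: _ => //; [exact: nowhere_dense0 | exact: nowhere_denseU].
Qed.

Lemma nowhere_dense_preimage {T U : topologicalType} {f : T -> U} {G : set U} :
  continuous f -> (forall O, open O -> open (f @` O)) ->
  nowhere_dense G -> nowhere_dense (f @^-1` G).
Proof.
move=> fC fO; rewrite !nowhere_denseP => dG O [x Ox] oO.
have [|_ [[y Oy <-] fyG]] := dG (f @` O) _ (fO _ oO); first by exists (f x), x.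
exists y; split=> // yG; apply: fyG.
have fcl : closed (f @^-1` closure G).
  by apply: preimage_closed; [move=> x' _; exact: fC | exact: closed_closure].
by apply: fcl; apply: closureS yG => x' ?; exact: subset_closure.
Qed.

Lemma meagerU (T : topologicalType) (G H : set T) :
  meager G -> meager H -> meager (G `|` H).
Proof.
move=> [F Fnd ->] [F' F'nd ->]; exists (fun n => F n `|` F' n).
  by move=> n; exact: nowhere_denseU.
by rewrite bigcupU.
Qed.

Lemma meager_preimage (T U : topologicalType) (f : T -> U) (G : set U) :
  continuous f -> (forall O, open O -> open (f @` O)) ->
  meager G -> meager (f @^-1` G).
Proof.
move=> fC fO [F Fnd ->]; exists (fun n => f @^-1` F n).
  by move=> n; exact: nowhere_dense_preimage.
by rewrite preimage_bigcup.
Qed.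

Definition agree (m n : nat) (x y : cantor_space) : Prop :=
  forall i, m <= i < n -> x i = y i.

Lemma nbhs_cantorP (x : cantor_space) (U : set cantor_space) :
  nbhs x U <-> exists n, [set y | agree 0 n y x] `<=` U.
Proof.
pose B n := [set y | agree 0 n y x].
split=> [|[n BU]].
  have FB : Filter (filter_from setT B).
    apply: filter_from_filter; first by exists 0.
    move=> i j _ _; exists (maxn i j) => // y yx.
    by split=> k hk; apply: yx; lia.
  have Bx : filter_from setT B --> x.
    apply/cvg_sup => N V [W] [[Z] oZ <-] ZxN ZV.
    apply: (filterS ZV); exists N.+1 => // y yx; move: ZxN => /=.
    by rewrite (yx N) //=.
  by move=> /Bx[n _ BU]; exists n.
apply: filterS BU _; elim: n => [|n IH].
  by apply: filterS filterT => y _ i; lia.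
have xn : nbhs x [set y : cantor_space | y n = x n].
  apply: (@proj_continuous nat (fun=> bool) n x [set b | b = x n]).
  by rewrite /= /proj; apply: (@discrete_set1 bool).
apply: filterS (filterI IH xn) => y [yx yxn] i /andP[_].
by rewrite ltnS leq_eqVlt => /predU1P[->//|iltn]; apply: yx.
Qed.

Definition flip (p x : cantor_space) : cantor_space := fun i => x i (+) p i.

Lemma flipK p : involutive (flip p).
Proof. by move=> x; apply/funext => i; rewrite /flip addbK. Qed.

Lemma flip_continuous p : continuous (flip p).
Proof.
move=> x V /nbhs_cantorP[n nV]; apply/nbhs_cantorP; exists n => y yx.
by apply: nV => i /yx; rewrite /flip => ->.
Qed.

Lemma flip_open p (O : set cantor_space) : open O -> open (flip p @` O).
Proof.
rewrite (_ : flip p @` O = flip p @^-1` O).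
  by move=> oO; apply: open_comp oO => x _; exact: flip_continuous.
apply/seteqP; split=> [_ [x Ox <-]|x Ox]; first by rewrite /preimage/= flipK.
by exists (flip p x); rewrite ?flipK.
Qed.

Definition tail_saturation a (G : set cantor_space) : set cantor_space :=
  [set x | exists2 w, G w & forall i, a <= i -> w i = x i].

(* Saturating one more coordinate adds only the flip of that coordinate. *)
Lemma nowhere_dense_tail_saturation a (G : set cantor_space) :
  nowhere_dense G -> nowhere_dense (tail_saturation a G).
Proof.
move=> Gnd; elim: a => [|a IH].
  apply: nowhere_denseS Gnd => x [w Gw wx].
  by rewrite (_ : x = w) //; apply/funext => i; rewrite wx.
pose p : cantor_space := fun i => i == a.
apply: nowhere_denseS (nowhere_denseU IH
  (nowhere_dense_preimage (flip_continuous p) (flip_open p) IH)).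
move=> x [w Gw wx]; have [wxa|wxa] := eqVneq (w a) (x a).
  by left; exists w => // i; rewrite leq_eqVlt => /predU1P[<-//|]; exact: wx.
right; exists w => // i; rewrite leq_eqVlt /flip /p => /predU1P[<-|ai].
  by rewrite eqxx; case: (w a) (x a) wxa => -[].
by rewrite wx // gtn_eqF ?addbF.
Qed.

Lemma nowhere_dense_block {G : set cantor_space} a : nowhere_dense G ->
  exists b (s : cantor_space),
    a <= b /\ forall x, agree a b x s -> ~ G x.
Proof.
move=> /(nowhere_dense_tail_saturation a)/nowhere_denseP.
move=> /(_ setT (ex_intro _ point I) openT)[s [_ sG]].
have /nbhs_cantorP[m ms] : nbhs s (~` tail_saturation a G).
  by move: sG; rewrite -interiorC.
exists (maxn a m), s; split=> [|x xs Gx]; first exact: leq_maxl.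
apply: (ms (fun i => if i < a then s i else x i)) => [i im|].
  by case: ltnP => // ai; apply: xs; lia.
by exists x => // i ai; rewrite ltnNge ai.
Qed.

Definition block (a b : nat -> nat) k : set nat := [set i | a k <= i < b k].

Definition separated_blocks (a b : nat -> nat) : Prop :=
  forall i k, i < k -> b i + k <= a k.

Lemma gap_separated_blocks a b :
  (forall k, a k <= b k) -> (forall k, b k + k < a k.+1) ->
  separated_blocks a b.
Proof.
move=> ab gap i; elim=> // k IH; rewrite ltnS leq_eqVlt => /predU1P[->|/IH].
  by have := gap k; lia.
by have := ab k; have := gap k; lia.
Qed.

Lemma separated_block_inj {a b i k n} : separated_blocks a b ->
  block a b i n -> block a b k n -> i = k.
Proof.
move=> sep /andP[? ?] /andP[? ?].
by case: (ltngtP i k) => // /sep; lia.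
Qed.

Lemma separated_blocks_ge {a b} k : separated_blocks a b -> k <= a k.
Proof. by case: k => // k /(_ 0 k.+1 isT); lia. Qed.

Lemma infinite_set_unbounded (D : set nat) : infinite_set D ->
  forall n, exists2 k, D k & n <= k.
Proof.
move=> Dinf n; have /infinite_setN0[k [Dk]] := infinite_setD Dinf (finite_II n).
by move=> /negP; rewrite -leqNgt; exists k.
Qed.

Lemma meager_matching_blocks (G : set cantor_space) : meager G ->
  exists a b (s : cantor_space), separated_blocks a b /\
    forall x, infinite_set [set k | agree (a k) (b k) x s] -> ~ G x.
Proof.
move=> [F Fnd ->].
have /choice[g gP] : forall ka : nat * nat, exists bs : nat * cantor_space,
    ka.2 <= bs.1 /\ forall x, agree ka.2 bs.1 x bs.2 ->
      ~ (\bigcup_(j < ka.1.+1) F j) x.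
  move=> [k a].
  have [b [s bsP]] := nowhere_dense_block a (nowhere_dense_bigcup k.+1 Fnd).
  by exists (b, s).
pose fix a k := if k is j.+1 then ((g (j, a j)).1 + j).+1 else 0.
pose b k := (g (k, a k)).1.
pose s i := `[< exists2 k, block a b k i & (g (k, a k)).2 i >].
have sep : separated_blocks a b.
  by apply: gap_separated_blocks => // k; case: (gP (k, a k)).
have s_block k : agree (a k) (b k) s (g (k, a k)).2.
  move=> i ik; apply/asboolP/idP => [[j ij]|]; last by exists k.
  by rewrite (separated_block_inj sep ij ik).
exists a, b, s; split=> // x /infinite_set_unbounded xs [n _ Fx].
have [k xsk nk] := xs n; have [_ avoid] := gP (k, a k).
apply: (avoid x); last by exists n.
by move=> i ik; exact: etrans (xsk i ik) (s_block k i ik).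
Qed.

Lemma cantor_Baire {G : set cantor_space} : meager G -> dense (~` G).
Proof.
move=> /meager_matching_blocks[a [b [s [sep sG]]]] O [x Ox] oO.
have /nbhs_cantorP[n nO] : nbhs x O by exact: open_nbhs_nbhs.
exists (fun i => if i < n then x i else s i).
split; first by apply: nO => i /= ->.
apply: sG; apply: sub_infinite_set (infinite_setD infinite_nat (finite_II n)).
move=> k [_ /negP nk] i ik; rewrite ltnNge (_ : n <= i) //.
by have := separated_blocks_ge k sep; move: nk ik => /=; lia.
Qed.

Lemma char_funK : cancel char_fun (fun x => [set n | x n]).
Proof. by move=> A; apply/seteqP; split=> n; rewrite /= /char_fun inE. Qed.

Lemma in_image_char_fun (I : set (set nat)) x :
  (char_fun @` I) x -> I [set n | x n].
Proof. by move=> [A IA <-]; rewrite char_funK. Qed.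

Lemma ideal_Baire_meager {I : set (set nat)} :
  is_ideal I -> ideal_Baire_property I -> meager (char_fun @` I).
Proof.
move=> [IU IS Ifin IT] [U oU]; set X := char_fun @` I => mXU.
suff U0 : U = set0 by rewrite -(setY0 X) -U0.
rewrite -subset0 => x Ux.
have XU y : U y -> ~ (X `+` U) y -> I [set n | y n].
  move=> Uy nXU; apply: in_image_char_fun.
  by apply: contrapT => nXy; apply: nXU; right.
have /nbhs_cantorP[N NU] : nbhs x U by exact: open_nbhs_nbhs.
pose f := flip (fun i => N <= i).
have oUf : open (U `&` f @^-1` U).
  by apply: openI => //; apply: open_comp oU => y _; exact: flip_continuous.
have UfN0 : (U `&` f @^-1` U) !=set0.
  exists x; split=> //; apply: NU => i /= iN.
  by rewrite /f /flip leqNgt iN addbF.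
have mG : meager ((X `+` U) `|` f @^-1` (X `+` U)).
  apply: meagerU => //; apply: meager_preimage mXU.
    exact: flip_continuous.
  exact: flip_open.
have [y [[Uy Ufy]]] := cantor_Baire mG _ UfN0 oUf.
move=> /not_orP[/(XU y Uy) Iy /(XU (f y) Ufy) Ify].
apply: IT; apply: IS (IU _ _ (Ifin _ (finite_II N)) (IU _ _ Iy Ify)) => n _ /=.
case: (ltnP n N) => nN; first by left.
by right; rewrite /f /flip nN addbT; case: (y n); [left|right].
Qed.

Lemma meager_hereditary_blocks {I : set (set nat)} :
  (forall A B, B `<=` A -> I A -> I B) -> meager (char_fun @` I) ->
  exists a b, separated_blocks a b /\
    forall D, infinite_set D -> ideal_pos I (\bigcup_(k in D) block a b k).
Proof.
move=> IS /meager_matching_blocks[a [b [s [sep sI]]]].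
exists a, b; split=> // D Dinf ID.
pose A := \bigcup_(k in D) block a b k `&` [set i | s i].
apply: (sI (char_fun A)); last by exists A => //; apply: IS ID => i [].
apply: sub_infinite_set Dinf => k Dk i ik; apply/idP/idP; rewrite inE.
  by case.
by split=> //; exists k.
Qed.

Lemma translate0 A : translate A 0 = A.
Proof.
apply/seteqP; split=> [n [a Aa]|n An]; first by rewrite addr0 => -[->].
by exists n; rewrite ?addr0.
Qed.

(* A shift by [t] can only make blocks [i] and [j] meet if [i = j] or both
   are at most [|t|]. *)
Lemma separated_blocks_translate_finite a b (D E : set nat) (t : int) :
  separated_blocks a b -> finite_set (D `&` E) ->
  finite_set (\bigcup_(k in D) block a b k `&`
    translate (\bigcup_(k in E) block a b k) t).
Proof.
move=> sep DEfin; pose K := (D `&` E) `|` `I_(absz t).+1.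
have Kfin : finite_set (\bigcup_(k in K) block a b k).
  apply: bigcup_finite => [|k _]; first by rewrite finite_setU.
  by apply: sub_finite_set (finite_II (b k)) => i /andP[].
apply: sub_finite_set Kfin => n [[j Dj nj] [m [i Ei mi] nm]]; exists j => //.
move: nj mi; rewrite /block /= => nj mi.
case: (ltngtP i j) => [ij|ji|ij].
- by right => /=; have := sep _ _ ij; lia.
- by right => /=; have := sep _ _ ji; lia.
- by left; split=> //; rewrite -ij.
Qed.

Section Branches.
Variable T : countType.
Implicit Types x y : nat -> T.

Definition branch x : set nat := range (fun n => pickle (mkseq x n)).

Lemma infinite_branch x : infinite_set (branch x).
Proof.
have codes_inj : {in [set: nat] &, injective (fun n => pickle (mkseq x n))}.
  by move=> m n _ _ /(pcan_inj pickleK)/(congr1 size); rewrite !size_mkseq.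
by apply/infiniteP; rewrite (card_le_eqr (inj_card_eq codes_inj)) card_lexx.
Qed.

Lemma finite_branchI x y : x <> y -> finite_set (branch x `&` branch y).
Proof.
move=> xy; have [d xyd] : exists d, x d <> y d.
  by apply/existsNP => exy; apply: xy; apply/funext.
apply: sub_finite_set (finite_image (fun n => pickle (mkseq x n))
  (finite_II d.+1)) => _ [[n _ <-] [m _ /(pcan_inj pickleK) yx]].
have mn : m = n by have := congr1 size yx; rewrite !size_mkseq.
exists n => //=; rewrite ltnS leqNgt; apply/negP => dn; apply: xyd.
by have := congr1 (nth (x 0) ^~ d) yx; rewrite !nth_mkseq // mn.
Qed.

End Branches.

Section BinarySum.
Variables (R : realType) (z : R).
Local Open Scope ring_scope.
Hypotheses (z_gt0 : 0 < z) (z_lt : z < 1 / 2).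

Definition binary_term (x : nat -> bool) : R^nat :=
  fun n => (x n)%:R * z ^+ n.

Definition binary_sum (x : nat -> bool) : R := limn (series (binary_term x)).

Let norm_z : `|z| < 1.
Proof. by rewrite gtr0_norm //; move: z_lt; lra. Qed.

Lemma binary_term_ge0 x n : 0 <= binary_term x n.
Proof. by rewrite mulr_ge0 ?exprn_ge0 // ltW. Qed.

Lemma binary_term_le x n : binary_term x n <= geometric 1 z n.
Proof. by rewrite ler_wpM2r ?exprn_ge0 ?(ltW z_gt0) //; case: (x n). Qed.

Lemma is_cvg_binary_sum x : cvgn (series (binary_term x)).
Proof.
apply: series_le_cvg (binary_term_ge0 x) _ (binary_term_le x) _.
  by move=> n; rewrite geometric_ge0 // ltW.
exact: is_cvg_geometric_series.
Qed.

Lemma binary_sum_ge0 x : 0 <= binary_sum x.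
Proof.
apply: limr_ge (is_cvg_binary_sum x) _; apply: nearW => n.
by apply: sumr_ge0 => i _; exact: binary_term_ge0.
Qed.

Lemma binary_sum_lt2 x : binary_sum x < 2.
Proof.
apply: (@le_lt_trans _ _ (1 - z)^-1); last first.
  by rewrite invf_plt ?posrE; move: z_lt; lra.
rewrite -[leRHS]mul1r -(cvg_lim _ (cvg_geometric_series (a := 1) norm_z)) //.
apply: lim_series_le (binary_term_le x); first exact: is_cvg_binary_sum.
exact: is_cvg_geometric_series.
Qed.

Lemma binary_sumS x : binary_sum x = (x 0%N)%:R + z * binary_sum (x \o S).
Proof.
apply: cvg_lim => //; rewrite -cvg_shiftS.
rewrite (_ : [sequence _]_n =
    fun n => (x 0%N)%:R + z * series (binary_term (x \o S)) n).
  by apply: cvgD; [exact: cvg_cst | apply: cvgMr; exact: is_cvg_binary_sum].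
apply/funext => n; rewrite /series /= big_nat_recl // /binary_term mulr1.
rewrite mulr_sumr; congr (_ + _).
by apply: eq_bigr => i _; rewrite exprS mulrCA.
Qed.

(* As [z < 1 / 2], the tail of the sum is below [1], so that the value of the
   sum determines its first digit. *)
Lemma binary_sum_head x y : binary_sum x = binary_sum y -> x 0%N = y 0%N.
Proof.
have tail_itv w : 0 <= z * binary_sum w < 1.
  rewrite mulr_ge0 ?binary_sum_ge0 ?(ltW z_gt0) //=.
  apply: (@le_lt_trans _ _ (z * 2)); last by move: z_lt; lra.
  by rewrite ler_pM2l // ltW ?binary_sum_lt2.
rewrite (binary_sumS x) (binary_sumS y).
have := tail_itv (x \o S); have := tail_itv (y \o S).
by case: (x 0%N) (y 0%N) => -[] //=; lra.
Qed.

Lemma binary_sum_inj : injective binary_sum.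
Proof.
have eq_tail x y : binary_sum x = binary_sum y ->
    binary_sum (x \o S) = binary_sum (y \o S).
  move=> xy; have := xy.
  rewrite (binary_sumS x) (binary_sumS y) (binary_sum_head _ _ xy).
  by move=> /addrI/mulfI; apply; rewrite gt_eqF.
move=> x y xy; apply/funext => n.
elim: n x y xy => [|n IH] x y xy; first exact: binary_sum_head.
exact: (IH (x \o S) (y \o S) (eq_tail _ _ xy)).
Qed.

End BinarySum.

Section Continuum.
Variable R : realType.
Local Open Scope ring_scope.

Definition rational_cut (r : R) : nat -> bool :=
  fun n => if unpickle n is Some q then ratr q < r else false.

Lemma rational_cut_inj : injective rational_cut.
Proof.
suff cut_lt r1 r2 : r1 < r2 -> rational_cut r1 <> rational_cut r2.
  by move=> r1 r2 e; case: (ltgtP r1 r2) => // /cut_lt; rewrite e.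
move=> /rat_in_itvoo[q]; rewrite in_itv /= => /andP[r1q qr2].
move=> /(congr1 (fun f => f (pickle q))).
by rewrite /rational_cut pickleK qr2 ltNge (ltW r1q).
Qed.

Lemma card_cantor_real : [set: nat -> bool] #= [set: R].
Proof.
rewrite card_eq_le; apply/andP; split; apply/pcard_injP.
  exists (binary_sum R (1 / 3)) => x y _ _.
  by apply: binary_sum_inj; lra.
by exists rational_cut => r1 r2 _ _; exact: rational_cut_inj.
Qed.

End Continuum.

Theorem theorem3p2 (R : realType) (I : set (set nat)) :
  is_ideal I -> ideal_Baire_property I ->
  exists2 F : set (set nat), TAD_family I F & F #= [set: R].
Proof.
move=> idealI BaireI; have [_ IS Ifin _] := idealI.
have [a [b [sep Ipos]]] :=
  meager_hereditary_blocks IS (ideal_Baire_meager idealI BaireI).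
pose A (x : nat -> bool) := \bigcup_(k in branch _ x) block a b k.
have Apos x : ideal_pos I (A x) by exact/Ipos/infinite_branch.
have AI x y t : x <> y -> I (A x `&` translate (A y) t).
  move=> xy; apply/Ifin/separated_blocks_translate_finite => //.
  exact: finite_branchI.
have Ainj : injective A.
  move=> x y Axy; apply: contrapT => /(AI x y 0%R).
  by rewrite translate0 -Axy setIid; exact: Apos.
exists (range A).
  split=> [_ [x _ <-]//|_ _ [x _ <-] [y _ <-] Axy k].
  by apply: AI => xy; apply: Axy; rewrite xy.
apply: card_eq_trans (card_cantor_real R).
by apply: inj_card_eq => x y _ _; exact: Ainj.
Qed.
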